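(* Let $d\ge 1$, $\nu>0$, $\gamma\ge 0$, and let $K\in C^\infty(\mathbb{T}^d)$ be real-valued, even, with $\int_{\mathbb{T}^d}K\,dx=0$. For $\xi\in\mathbb{Z}^d\setminus\{0\}$ let $k_\xi=(2\pi|\xi|)^2$, $$M_\xi=\begin{pmatrix}\nu k_\xi & -\gamma\widehat K(\xi)\\ -k_\xi & -\nu k_\xi\end{pmatrix},\qquad \sigma_\xi(\gamma)=\nu^2k_\xi^2+\gamma k_\xi\widehat K(\xi).$$ Then for every $\xi\in\mathbb{Z}^d\setminus\{0\}$ one has $M_\xi^2=\sigma_\xi(\gamma)I$. Hence: (i) if $\sigma_\xi(\gamma)>0$, the eigenvalues of $M_\xi$ are $\pm\sqrt{\sigma_\xi(\gamma)}$; (ii) if $\sigma_\xi(\gamma)=0$, then $0$ is a double eigenvalue of $M_\xi$ and $M_\xi$ is nilpotent of index $2$; (iii) if $\sigma_\xi(\gamma)<0$, the eigenvalues of $M_\xi$ are purely imaginary, namely $\pm i\sqrt{|\sigma_\xi(\gamma)|}$. Moreover, the following are equivalent: (a) $\sigma_\xi(\gamma)>0$ for all $\xi\in\mathbb{Z}^d\setminus\{0\}$; (b) $\gamma<\gamma_c$; (c) the linearization around the uniform equilibrium has no neutral Fourier mode. Finally, suppose that $\gamma_c<\infty$ and that the set $$\mathcal{C}=\Bigl\{\xi\in\mathbb{Z}^d\setminus\{0\}:\ \widehat K(\xi)<0,\ \frac{\nu^2(2\pi|\xi|)^2}{|\widehat K(\xi)|}=\gamma_c\Bigr\}$$ consists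 of a single pair $\{\pm\xi_0\}$ for some $\xi_0\in\mathbb{Z}^d\setminus\{0\}$. Then, as $\gamma\uparrow\gamma_c$, $$\rho(\gamma)=C_*\sqrt{\gamma_c-\gamma}+o\bigl(\sqrt{\gamma_c-\gamma}\bigr),\qquad C_*=\sqrt{k_{\xi_0}\,|\widehat K(\xi_0)|}.$$
   Context: $\mathbb{T}^d=(\mathbb{R}/\mathbb{Z})^d$ is the flat torus, and $\widehat f(\xi)=\int_{\mathbb{T}^d}f(x)e^{-2\pi i\xi\cdot x}\,dx$ for $\xi\in\mathbb{Z}^d$. Since $K$ is real and even, $\widehat K(\xi)\in\mathbb{R}$ and $\widehat K(-\xi)=\widehat K(\xi)$. The critical coupling is $$\gamma_c=\min_{\xi\in\mathbb{Z}^d\setminus\{0\},\ \widehat K(\xi)<0}\frac{\nu^2(2\pi|\xi|)^2}{|\widehat K(\xi)|},$$ with $\gamma_c=+\infty$ if no $\xi\neq0$ satisfies $\widehat K(\xi)<0$. For $0\le\gamma<\gamma_c$ the spectral gap is $\rho(\gamma)=\min_{\xi\ne0}\sqrt{\sigma_\xi(\gamma)}$. The mean-field game system is $$-\partial_t\phi-\nu\Delta\phi+\tfrac12|\nabla\phi|^2=\gamma K*m,\qquad \partial_tm-\nu\Delta m-\mathrm{div}(m\nabla\phi)=0.$$ Its uniform equilibrium is $\phi=0$, $m=1$. The linearization around it, for mean-zero perturbations $w$ of $\phi$ and $\mu$ of $m$, is $$-\partial_tw-\nu\Delta w=\gamma K*\mu,\qquad \partial_t\mu-\nu\Delta\mu-\Delta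 w=0,$$ which in Fourier variables reads $\frac{d}{dt}(\widehat w_\xi,\widehat\mu_\xi)^{\top}=M_\xi(\widehat w_\xi,\widehat\mu_\xi)^{\top}$ for each $\xi\ne0$. A Fourier mode $\xi\neq0$ is called neutral if $M_\xi$ has an eigenvalue with zero real part. *)

(* Defs.v *)
From HB Require Import structures.
From mathcomp Require Import all_boot all_order all_algebra.
From mathcomp Require Import complex.
From mathcomp Require Import all_classical all_reals all_analysis.

Set Implicit Arguments.
Unset Strict Implicit.
Unset Printing Implicit Defensive.

Import Order.TTheory GRing.Theory Num.Theory.
Import numFieldNormedType.Exports.

Local Open Scope classical_set_scope.
Local Open Scope complex_scope.
Local Open Scope ring_scope.

(* Functions on the torus (R/Z)^d are represented by Z^d-periodic functions
   on R^d = 'rV[R]_d. *)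
Definition Zd_periodic (R : realType) (d : nat) (f : 'rV[R]_d -> R) : Prop :=
  forall (x : 'rV[R]_d) (z : 'rV[int]_d), f (x + map_mx intr z) = f x.

(* iter_partial [:: i1; ...; ik] f = \partial_i1 ... \partial_ik f *)
Definition iter_partial (R : realType) (d : nat) (s : seq 'I_d)
    (f : 'rV[R]_d -> R) : 'rV[R]_d -> R :=
  foldr (fun i g => 'D_(delta_mx ord0 i) g) f s.

(* C^oo: the partial derivatives of all orders exist and are continuous;
   'D_v is a total operator, hence the explicit derivability clause. *)
Definition smooth (R : realType) (d : nat) (f : 'rV[R]_d -> R) : Prop :=
  forall s : seq 'I_d,
    continuous (iter_partial s f) /\
    forall (i : 'I_d) (x : 'rV[R]_d),
      derivable (iter_partial s f) x (delta_mx ord0 i).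

(* Integral over the fundamental domain [0, 1]^d, as an iterated Lebesgue
   integral: the Lebesgue measure on R^d is not in the library, and the two
   agree by Fubini on the continuous functions considered here. *)
Fixpoint torus_integral (R : realType) (d : nat) : ('rV[R]_d -> R) -> R :=
  match d return ('rV[R]_d -> R) -> R with
  | 0 => fun f => f 0
  | d'.+1 => fun f =>
      \int[lebesgue_measure]_(t in `[0, 1])
        torus_integral (fun y : 'rV[R]_d' => f (row_mx (t%:M : 'rV[R]_1) y))
  end.

Definition idot (R : realType) (d : nat) (xi : 'rV[int]_d) (x : 'rV[R]_d) : R :=
  \sum_(i < d) (xi ord0 i)%:~R * x ord0 i.

(* \int f(x) exp(- 2 pi i xi.x) dx for real-valued f, split into its real and
   imaginary parts. *)
Definition fourier_coef (R : realType) (d : nat) (f : 'rV[R]_d -> R)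
    (xi : 'rV[int]_d) : R[i] :=
  torus_integral (fun x => f x * cos (2 * pi * idot xi x)) -i*
  torus_integral (fun x => f x * sin (2 * pi * idot xi x)).

(* The Fourier coefficient as a real number, for f real-valued and even. *)
Definition hat (R : realType) (d : nat) (f : 'rV[R]_d -> R)
    (xi : 'rV[int]_d) : R := complex.Re (fourier_coef f xi).

(* Euclidean norm (the norm of 'rV[R]_d in the library is the sup norm). *)
Definition enorm (R : realType) (d : nat) (xi : 'rV[int]_d) : R :=
  Num.sqrt (\sum_(i < d) ((xi ord0 i)%:~R) ^+ 2).

Definition kxi (R : realType) (d : nat) (xi : 'rV[int]_d) : R :=
  (2 * pi * enorm R xi) ^+ 2.

(* The entries use the complex Fourier coefficient, whereas sigma below uses
   its real part: M_xi ^+ 2 = sigma I thus also asserts that the coefficient is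
   real (if gamma != 0). *)
Definition Mxi (R : realType) (d : nat) (nu : R) (K : 'rV[R]_d -> R)
    (gamma : R) (xi : 'rV[int]_d) : 'M[R[i]]_2 :=
  @block_mx _ 1 1 1 1
    ((nu * kxi R xi)%:C%:M) ((- (gamma%:C * fourier_coef K xi))%:M)
    ((- (kxi R xi)%:C)%:M)  ((- (nu * kxi R xi)%:C)%:M).

Definition sigma (R : realType) (d : nat) (nu : R) (K : 'rV[R]_d -> R)
    (xi : 'rV[int]_d) (gamma : R) : R :=
  nu ^+ 2 * kxi R xi ^+ 2 + gamma * kxi R xi * hat K xi.

(* The minimum of A if it is attained, and x0 otherwise. *)
Definition set_min (disp : Order.disp_t) (T : porderType disp) (x0 : T)
    (A : set T) : T :=
  xget x0 (A `&` lbound A).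

Definition critical_ratio (R : realType) (d : nat) (nu : R)
    (K : 'rV[R]_d -> R) (xi : 'rV[int]_d) : R :=
  nu ^+ 2 * (2 * pi * enorm R xi) ^+ 2 / `|hat K xi|.

Definition gamma_c (R : realType) (d : nat) (nu : R) (K : 'rV[R]_d -> R)
    : \bar R :=
  set_min +oo%E
    [set (critical_ratio nu K xi)%:E |
      xi in [set xi : 'rV[int]_d | xi != 0 /\ hat K xi < 0]].

Definition critical_set (R : realType) (d : nat) (nu : R) (K : 'rV[R]_d -> R)
    : set 'rV[int]_d :=
  [set xi | [/\ xi != 0, hat K xi < 0 &
                (critical_ratio nu K xi)%:E = gamma_c nu K]].

Definition rho (R : realType) (d : nat) (nu : R) (K : 'rV[R]_d -> R)
    (gamma : R) : R :=
  set_min 0 [set Num.sqrt (sigma nu K xi gamma) |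
              xi in [set xi : 'rV[int]_d | xi != 0]].

(* M_xi is the matrix of the xi-th Fourier mode of the linearization
     - w_t - nu Lap w = gamma K * mu,    mu_t - nu Lap mu - Lap w = 0
   of the mean-field game system around (phi, m) = (0, 1). *)
Definition neutral_mode (R : realType) (d : nat) (nu : R) (K : 'rV[R]_d -> R)
    (gamma : R) (xi : 'rV[int]_d) : Prop :=
  xi != 0 /\
  exists lam : R[i],
    eigenvalue (Mxi nu K gamma xi) lam /\ complex.Re lam = 0.

Definition nilpotent_of_index (F : fieldType) (n : nat) (A : 'M[F]_n.+1)
    (p : nat) : Prop :=
  A ^+ p = 0 /\ forall q : nat, (q < p)%N -> A ^+ q <> 0.

(* Main.v *)
(* M_xi is traceless with determinant - sigma_xi, provided that hat K(xi) is
   real; hence M_xi^2 = sigma_xi I and lam is an eigenvalue iff lam^2 = sigma_xi.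
   Reality of hat K(xi) is the vanishing of the integral of the odd periodic
   function K(x) sin(2 pi xi.x), which follows from the invariance of the
   iterated torus integral under x |-> - x.
   Since |hat K| <= ||K||_1, the ratios nu^2 k_xi / |hat K(xi)| and the values
   sigma_xi(gamma) tend to infinity with |xi|, so their minima over subsets of
   Z^d are attained. In particular gamma_c is attained, and the sigma_xi with
   xi distinct from 0 and +-xi0 stay above some delta > 0 for all gamma in
   [0, gamma_c]. As sigma_xi0(gamma) = k_xi0 |hat K(xi0)| (gamma_c - gamma) falls
   below delta near gamma_c, the remainder in the expansion of rho is then
   exactly zero. *)
Require Import Defs.
From HB Require Import structures.
From mathcomp Require Import all_boot all_order all_algebra.
From mathcomp Require Import complex.
From mathcomp Require Import all_classical all_reals all_analysis.
From mathcomp Require Import zify ring lra.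

Set Implicit Arguments.
Unset Strict Implicit.
Unset Printing Implicit Defensive.

Import Order.TTheory GRing.Theory Num.Theory.
Import numFieldNormedType.Exports.

Local Open Scope classical_set_scope.
Local Open Scope complex_scope.
Local Open Scope ring_scope.

(** * Continuity of iterated torus integrals in a parameter *)

Lemma continuous_pair (T U V : topologicalType) (f : T -> U) (g : T -> V) :
  continuous f -> continuous g -> continuous (fun x => (f x, g x)).
Proof. by move=> cf cg x; exact: (cvg_pair (cf x) (cg x)). Qed.

Lemma continuous_mx (T U : topologicalType) (m n : nat) (f : T -> 'M[U]_(m, n)) :
  (forall i j, continuous (fun x => f x i j)) -> continuous f.
Proof.
move=> cf x A [P P_nbhs sPA].
suff : \forall y \near x, forall i j, P i j (f y i j).
  by apply: filterS => y; exact: sPA.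
by apply: filter_forall => i; apply: filter_forall => j; apply: cf.
Qed.

Lemma continuous_row_mx_scalar (R : realType) (d : nat) :
  continuous (fun p : R * 'rV[R]_d => row_mx (p.1%:M : 'rV[R]_1) p.2).
Proof.
apply: continuous_mx => i j; case: (split_ordP j) => k ->.
- under eq_fun do rewrite row_mxEl mxE.
  rewrite (ord1 i) (ord1 k) eqxx /=.
  by under eq_fun do rewrite mulr1n; move=> p; exact: cvg_fst.
- under eq_fun do rewrite row_mxEr.
  move=> p; apply: (@continuous_comp _ _ _ snd (fun M : 'rV[R]_d => M i k)).
    exact: cvg_snd.
  exact: coord_continuous.
Qed.

Lemma continuous_integrable01 (R : realType) (f : R -> R) :
  continuous f -> (@lebesgue_measure R).-integrable `[0, 1] (EFin \o f).
Proof.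
move=> cf; apply: continuous_compact_integrable; first exact: segment_compact.
exact: continuous_subspaceT.
Qed.

(** By compactness of [0, 1], [G q] tends to [G p] uniformly in [t] as [q] tends to [p]; integrals
    over an interval of length 1 then differ by at most the uniform distance. *)
Lemma continuous_parametric_integral (R : realType) (T : topologicalType)
    (G : T -> R -> R) :
  continuous (fun p : T * R => G p.1 p.2) ->
  continuous (fun p => \int[lebesgue_measure]_(t in `[0, 1]) G p t).
Proof.
move=> cG p; have cGp q : continuous (G q).
  move=> t; apply: (@continuous_comp _ _ _ (fun t => (q, t)) (fun p => G p.1 p.2)).
    by apply: continuous_pair => z; [exact: cst_continuous|exact: cvg_id].
  exact: cG.
apply/cvgrPdist_le => /= e e0.
have /compact_near_coveringP near01 := @segment_compact R 0 1.
have : \forall q \near p, `[0, 1] `<=` [set t | `|G p t - G q t| <= e].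
  apply: (near01 T (nbhs p) (fun q t => `|G p t - G q t| <= e)) => t _.
  have e20 : 0 < e / 2 by rewrite divr_gt0.
  have [[A B] /= [At Bt] AB] := (cvgrPdist_le _ _).1 (cG (p, t)) _ e20.
  near=> s q => /=.
  have As : A q by near: q.
  have Bs : B s by near: s.
  have h1 : `|G p t - G q s| <= e / 2 by apply: (AB (q, s)).
  have h2 : `|G p t - G p s| <= e / 2.
    by apply: (AB (p, s)); split => //=; exact: nbhs_singleton At.
  (* Both values at [s] are compared with the value at the centre [(p, t)], whence [e / 2]. *)
  rewrite (_ : _ - _ = (G p t - G q s) - (G p t - G p s)); last by ring.
  by rewrite (le_trans (ler_normB _ _))// [leRHS]splitr lerD.
apply: filterS => q Gpq.
rewrite -RintegralB //; [|exact: continuous_integrable01..].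
have cB : continuous (fun t => G p t - G q t).
  by move=> t; apply: cvgB; exact: cGp.
apply: le_trans (le_normr_Rintegral _ (continuous_integrable01 cB)) _ => //.
have -> : e = \int[@lebesgue_measure R]_(t in `[0, 1]) e.
  rewrite Rintegral_cst// [X in fine X](_ : _ = 1%E) ?mulr1//.
  by rewrite [LHS](lebesgue_measure_itv `[0, 1])/= lte_fin ltr01 oppr0 adde0.
apply: le_Rintegral => //.
- apply: continuous_integrable01 => t; apply: cvg_norm; exact: cB.
- apply: continuous_integrable01 => t; exact: cvg_cst.
Unshelve. all: by end_near. Qed.

(** [T] is generalized in the induction: the outer integration variable joins the parameter, which
    then ranges over [T * R]. *)
Lemma continuous_torus_integral (R : realType) (T : topologicalType) (d : nat)
    (f : T -> 'rV[R]_d -> R) :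
  continuous (fun p : T * 'rV[R]_d => f p.1 p.2) ->
  continuous (fun p => torus_integral (f p)).
Proof.
elim: d T f => [|d IHd] T f cf /=.
  move=> p; apply: (@continuous_comp _ _ _ (fun p => (p, 0 : 'rV[R]_0))
    (fun p => f p.1 p.2)).
    by apply: continuous_pair => z; [exact: cvg_id|exact: cvg_cst].
  exact: cf.
apply: continuous_parametric_integral.
apply: (IHd _ (fun (p : T * R) y => f p.1 (row_mx p.2%:M y))) => p.
apply: (@continuous_comp _ _ _
  (fun p : T * R * 'rV[R]_d => (p.1.1, row_mx (p.1.2%:M : 'rV[R]_1) p.2))
  (fun p => f p.1 p.2)); last exact: cf.
move: p; apply: continuous_pair => p.
  by apply: (@continuous_comp _ _ _ fst fst); exact: cvg_fst.
apply: (@continuous_comp _ _ _ (fun p : T * R * 'rV[R]_d => (p.1.2, p.2))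
  (fun p : R * 'rV[R]_d => row_mx (p.1%:M : 'rV[R]_1) p.2)); last first.
  exact: continuous_row_mx_scalar.
move: p; apply: continuous_pair => p; last exact: cvg_snd.
by apply: (@continuous_comp _ _ _ fst snd); [exact: cvg_fst|exact: cvg_snd].
Qed.

Lemma continuous_slice (R : realType) (d : nat) (f : 'rV[R]_d.+1 -> R) (t : R) :
  continuous f ->
  continuous (fun y : 'rV[R]_d => f (row_mx (t%:M : 'rV[R]_1) y)).
Proof.
move=> cf y; apply: continuous_comp; last exact: cf.
apply: (@continuous_comp _ _ _ (fun y : 'rV[R]_d => (t, y))
  (fun p => row_mx p.1%:M p.2)).
  by apply: continuous_pair => z; [exact: cst_continuous|exact: cvg_id].
exact: (@continuous_row_mx_scalar R d (t, y)).
Qed.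

Lemma continuous_torus_integral_slice (R : realType) (d : nat)
    (f : 'rV[R]_d.+1 -> R) :
  continuous f ->
  continuous (fun t : R =>
    torus_integral (fun y : 'rV[R]_d => f (row_mx (t%:M : 'rV[R]_1) y))).
Proof.
move=> cf; apply: continuous_torus_integral => p.
apply: continuous_comp; last exact: cf.
exact: continuous_row_mx_scalar.
Qed.

(** * Monotonicity and reflection invariance of the torus integral *)

Lemma le_torus_integral (R : realType) (d : nat) (f g : 'rV[R]_d -> R) :
  continuous f -> continuous g -> (forall x, f x <= g x) ->
  torus_integral f <= torus_integral g.
Proof.
elim: d f g => [|d IHd] f g cf cg fg /=; first exact: fg.
apply: le_Rintegral => //.
- exact: continuous_integrable01 (continuous_torus_integral_slice cf).
- exact: continuous_integrable01 (continuous_torus_integral_slice cg).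
- by move=> t _; apply: IHd => //; exact: continuous_slice.
Qed.

Lemma torus_integralN (R : realType) (d : nat) (f : 'rV[R]_d -> R) :
  continuous f -> torus_integral (fun x => - f x) = - torus_integral f.
Proof.
elim: d f => [|d IHd] f cf //=.
rewrite -mulN1r -RintegralZl//; last first.
  exact: continuous_integrable01 (continuous_torus_integral_slice cf).
apply: eq_Rintegral => t _; rewrite mulN1r; apply: IHd.
exact: continuous_slice.
Qed.

(** The substitution t -> 1 - t preserves [0, 1], and periodicity turns g(1 - t) into g(- t). *)
Lemma Rintegral01_opp (R : realType) (g : R -> R) :
  continuous g -> (forall t, g (t + 1) = g t) ->
  \int[lebesgue_measure]_(t in `[0, 1]) g (- t) =
  \int[lebesgue_measure]_(t in `[0, 1]) g t.
Proof.
move=> cg g1.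
have F'E : derive1 (fun t : R => 1 - t) = cst (-1).
  by apply/funext => t; rewrite derive1E deriveB// derive_cst derive_id sub0r.
rewrite /Rintegral; congr fine.
have := @integration_by_substitution_decreasing R (fun t : R => 1 - t) g 0 1 ler01.
rewrite F'E subrr subr0 => ->.
- by apply: eq_integral => t _; rewrite !fctE opprK mulr1 addrC g1.
- by move=> x y _ _ xy; rewrite ltrD2l ltrN2.
- by move=> t _; exact: cvg_cst.
- exact: is_cvg_cst.
- exact: is_cvg_cst.
- split.
  + by move=> t _; exact: derivableB.
  + by apply: cvg_at_right_filter; apply: cvgB; [exact: cst_continuous|exact: cvg_id].
  + by apply: cvg_at_left_filter; apply: cvgB; [exact: cst_continuous|exact: cvg_id].
- exact: continuous_subspaceT.
Qed.

(** Taking [n = 0] or [z = 0] extracts from [Zd_periodic] the periodicity of each slice or that in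
    the first coordinate. *)
Lemma row_mx_scalarD_int (R : realType) (d : nat) (t : R) (n : int)
    (y : 'rV[R]_d) (z : 'rV[int]_d) :
  (row_mx (t%:M : 'rV[R]_1) y : 'rV[R]_d.+1) +
    map_mx intr (row_mx (n%:M : 'rV[int]_1) z : 'rV[int]_d.+1) =
  row_mx ((t + n%:~R)%:M : 'rV[R]_1) (y + map_mx intr z).
Proof.
rewrite [map_mx _ _](map_row_mx intr (n%:M : 'rV[int]_1)) map_scalar_mx.
by rewrite [LHS](add_row_mx (t%:M : 'rV[R]_1)) raddfD.
Qed.

(** Induction on [d]: the inner variables are reflected on the slice at [- t], then
    [Rintegral01_opp] reflects the outer one. *)
Lemma torus_integral_opp (R : realType) (d : nat) (f : 'rV[R]_d -> R) :
  continuous f -> Zd_periodic f ->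
  torus_integral (fun x => f (- x)) = torus_integral f.
Proof.
elim: d f => [|d IHd] f cf pf /=; first by rewrite oppr0.
pose g (t : R) := torus_integral (fun y : 'rV[R]_d => f (row_mx t%:M y)).
transitivity (\int[@lebesgue_measure R]_(t in `[0, 1]) g (- t)).
  apply: eq_Rintegral => t _.
  have -> : (fun y : 'rV[R]_d => f (- row_mx (t%:M : 'rV[R]_1) y)) =
            (fun y => f (row_mx ((- t)%:M : 'rV[R]_1) (- y))).
    apply/funext => y; congr f.
    by rewrite [LHS](opp_row_mx (t%:M : 'rV[R]_1)) raddfN.
  apply: (IHd (fun y => f (row_mx ((- t)%:M : 'rV[R]_1) y))).
    exact: continuous_slice.
  move=> y z; rewrite -[RHS](pf _ (row_mx ((0 : int)%:M : 'rV[int]_1) z)).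
  by rewrite row_mx_scalarD_int addr0.
apply: Rintegral01_opp; first exact: continuous_torus_integral_slice.
move=> t; congr torus_integral; apply/funext => y.
rewrite -[RHS](pf _ (row_mx ((1 : int)%:M : 'rV[int]_1) 0)).
by rewrite row_mx_scalarD_int map_mx0 addr0.
Qed.

Lemma torus_integral_odd (R : realType) (d : nat) (f : 'rV[R]_d -> R) :
  continuous f -> Zd_periodic f -> (forall x, f (- x) = - f x) ->
  torus_integral f = 0.
Proof.
move=> cf pf oddf; have := torus_integral_opp cf pf.
under [X in torus_integral X]eq_fun do rewrite oddf.
by rewrite torus_integralN// => ?; lra.
Qed.

Lemma le_norm_torus_integral (R : realType) (d : nat) (f g : 'rV[R]_d -> R) :
  continuous f -> continuous g -> (forall x, `|f x| <= g x) ->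
  `|torus_integral f| <= torus_integral g.
Proof.
move=> cf cg fg; rewrite ler_norml -torus_integralN//.
by apply/andP; split; apply: le_torus_integral => // x;
  [apply: continuousN; exact: cg|have /ler_normlP[] := fg x => *; lra..].
Qed.

(** * Trigonometric phases and Fourier coefficients *)

Lemma continuous_idot (R : realType) (d : nat) (xi : 'rV[int]_d) :
  continuous (@idot R d xi).
Proof.
apply: continuous_big => [|i _ x]; first exact: add_continuous.
by apply: continuousM; [exact: cst_continuous|exact: coord_continuous].
Qed.

Lemma idotD (R : realType) (d : nat) (xi : 'rV[int]_d) (x y : 'rV[R]_d) :
  idot xi (x + y) = idot xi x + idot xi y.
Proof. by rewrite -big_split; apply: eq_bigr => i _; rewrite mxE mulrDr. Qed.

Lemma idotN (R : realType) (d : nat) (xi : 'rV[int]_d) (x : 'rV[R]_d) :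
  idot xi (- x) = - idot xi x.
Proof. by rewrite -sumrN; apply: eq_bigr => i _; rewrite mxE mulrN. Qed.

Lemma idotNl (R : realType) (d : nat) (xi : 'rV[int]_d) (x : 'rV[R]_d) :
  idot (- xi) x = - idot xi x.
Proof. by rewrite -sumrN; apply: eq_bigr => i _; rewrite mxE rmorphN mulNr. Qed.

Lemma idot_int (R : realType) (d : nat) (xi z : 'rV[int]_d) :
  idot xi (map_mx intr z : 'rV[R]_d) = (\sum_i xi ord0 i * z ord0 i)%:~R.
Proof. by rewrite rmorph_sum; apply: eq_bigr => i _; rewrite mxE rmorphM. Qed.

Lemma sin_periodic_int (R : realType) (t : R) (n : int) :
  sin (2 * pi * (t + n%:~R)) = sin (2 * pi * t).
Proof.
have sin_nat (s : R) (m : nat) : sin (2 * pi * (s + m%:R)) = sin (2 * pi * s).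
  by rewrite mulrDr mulr_natr (mulr_natl pi 2) (periodicn (@sinD2pi R)).
case: n => m; first exact: sin_nat.
(* A negative shift is undone by adding its absolute value [m.+1]. *)
by rewrite -(sin_nat _ m.+1) NegzE rmorphN /= addrNK.
Qed.

Section Fourier.
Variables (R : realType) (d : nat) (K : 'rV[R]_d -> R).
Hypothesis K_continuous : continuous K.

Lemma continuous_Ksin (xi : 'rV[int]_d) :
  continuous (fun x => K x * sin (2 * pi * idot xi x)).
Proof.
move=> x; apply: continuousM; first exact: K_continuous.
apply: (@continuous_comp _ _ _ (fun x => 2 * pi * idot xi x) sin).
  by apply: continuousM; [exact: cst_continuous|exact: continuous_idot].
exact: continuous_sin.
Qed.

Lemma continuous_Kcos (xi : 'rV[int]_d) :
  continuous (fun x => K x * cos (2 * pi * idot xi x)).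
Proof.
move=> x; apply: continuousM; first exact: K_continuous.
apply: (@continuous_comp _ _ _ (fun x => 2 * pi * idot xi x) cos).
  by apply: continuousM; [exact: cst_continuous|exact: continuous_idot].
exact: continuous_cos.
Qed.

Lemma fourier_coef_even (xi : 'rV[int]_d) :
  Zd_periodic K -> (forall x, K (- x) = K x) ->
  fourier_coef K xi = (hat K xi)%:C.
Proof.
move=> pK evenK; rewrite /hat /fourier_coef /=.
rewrite (@torus_integral_odd _ _ (fun x => K x * sin (2 * pi * idot xi x))).
- by rewrite oppr0.
- exact: continuous_Ksin.
- by move=> x z; rewrite pK idotD idot_int sin_periodic_int.
- by move=> x; rewrite evenK idotN mulrN sinN mulrN.
Qed.

(** A bound independent of [xi], from |cos| <= 1; the coercivity of the critical ratios and of
    [sigma] rests on it. *)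
Lemma norm_hat_le (xi : 'rV[int]_d) :
  `|hat K xi| <= torus_integral (fun x => `|K x|).
Proof.
apply: le_norm_torus_integral; first exact: continuous_Kcos.
  move=> x; apply: continuous_comp; first exact: K_continuous.
  exact: norm_continuous.
by move=> x; rewrite normrM ler_piMr// ler_norml cos_geN1 cos_le1.
Qed.

End Fourier.

Lemma hatN (R : realType) (d : nat) (K : 'rV[R]_d -> R) (xi : 'rV[int]_d) :
  hat K (- xi) = hat K xi.
Proof.
rewrite /hat /=; congr torus_integral; apply/funext => x.
by rewrite idotNl mulrN cosN.
Qed.

(** * Minima of coercive functions on the integer lattice *)

Section Lattice.
Variables (R : realType) (d : nat).
Implicit Types xi eta : 'rV[int]_d.

Lemma enorm_sqr xi : enorm R xi ^+ 2 = \sum_(i < d) ((xi ord0 i)%:~R) ^+ 2.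
Proof. by rewrite sqr_sqrtr// sumr_ge0// => i _; exact: sqr_ge0. Qed.

Lemma kxiE xi : kxi R xi = (2 * pi) ^+ 2 * enorm R xi ^+ 2.
Proof. by rewrite /kxi exprMn. Qed.

Lemma enormN xi : enorm R (- xi) = enorm R xi.
Proof.
rewrite /enorm; congr Num.sqrt; apply: eq_bigr => i _.
by rewrite mxE rmorphN sqrrN.
Qed.

(** An integer n satisfies |n| <= n^2, so a bound on the squared norm bounds the coordinates without
    a square root. *)
Lemma le_coord_enorm_sqr xi i : `|xi ord0 i|%N%:R <= enorm R xi ^+ 2.
Proof.
rewrite enorm_sqr (bigD1 i)//= ler_wpDr//.
  by apply: sumr_ge0 => j _; exact: sqr_ge0.
rewrite pmulrn -rmorphXn ler_int; nia.
Qed.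

Lemma enorm_gt0 xi : xi != 0 -> 0 < enorm R xi.
Proof.
move=> xi0; rewrite lt0r sqrtr_ge0 andbT; apply: contra xi0 => /eqP xi0.
apply/eqP/rowP => i; rewrite mxE; have := le_coord_enorm_sqr xi i.
by rewrite xi0 expr0n/= lern0 absz_eq0 => /eqP.
Qed.

Lemma kxi_gt0 xi : xi != 0 -> 0 < kxi R xi.
Proof. by move=> xi0; rewrite exprn_gt0// !mulr_gt0 ?pi_gt0 ?enorm_gt0. Qed.

Lemma coercive_minimum (A : set 'rV[int]_d) (f : 'rV[int]_d -> R) (a b : R) :
  0 < a -> (forall xi, A xi -> a * enorm R xi ^+ 2 - b <= f xi) -> A !=set0 ->
  exists2 xi, A xi & forall eta, A eta -> f xi <= f eta.
Proof.
(* {xi in A | f xi <= f xi1} lies in the box [-N, N]^d. *)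
move=> a0 f_ge [xi1 Axi1]; pose N := Num.truncn ((f xi1 + b) / a).
(* The box is the image of a finite type, each coordinate being shifted by [N], so that [arg_minP]
   applies. *)
pose g (m : 'rV['I_(N + N).+1]_d) : 'rV[int]_d :=
  map_mx (fun j : 'I_(N + N).+1 => (j : nat)%:Z - N%:Z) m.
have g_onto eta : A eta -> f eta <= f xi1 -> exists m, g m = eta.
  move=> Aeta feta; exists (map_mx (fun n : int => inord `|(n + N%:Z)%R|%N) eta).
  apply/rowP => i; rewrite !mxE.
  (* Coercivity gives a |eta|^2 <= f xi1 + b, and |eta|^2 dominates each coordinate. *)
  have etaN : (`|eta 0%R i| <= N)%N.
    rewrite truncn_ge_nat; last first.
      rewrite divr_ge0 ?(ltW a0)//; have := f_ge _ Aeta.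
      have := mulr_ge0 (ltW a0) (sqr_ge0 (enorm R eta)); lra.
    apply: le_trans (le_coord_enorm_sqr eta i) _.
    by rewrite ler_pdivlMr// mulrC; have := f_ge _ Aeta; lra.
  by rewrite inordK; lia.
have [m1 m1E] := g_onto _ Axi1 (lexx _).
pose P m := `[< A (g m) >] && (f (g m) <= f xi1).
have Pm1 : P m1 by rewrite /P m1E lexx andbT; apply/asboolP.
case: (arg_minP (f \o g) Pm1) => m /andP[/asboolP Am fm] m_min.
(* Outside the sublevel set [f] exceeds [f xi1], so the minimum found inside is global on [A]. *)
exists (g m) => // eta Aeta; have [feta|/ltW] := leP (f eta) (f xi1); last first.
  exact: le_trans.
have [k kE] := g_onto _ Aeta feta.
by rewrite -kE; apply: m_min; rewrite /P kE feta andbT; apply/asboolP.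
Qed.

End Lattice.

(** Antisymmetry makes a least element unique, so [xget] can only choose [m]. *)
Lemma set_min_eq (disp : Order.disp_t) (T : porderType disp) (x0 m : T)
    (A : set T) :
  A m -> lbound A m -> set_min x0 A = m.
Proof.
move=> Am lbm; have [Az lbz] : (A `&` lbound A) (set_min x0 A).
  by apply: (@xgetPex _ x0); exists m.
by apply: le_anti; rewrite lbm// lbz.
Qed.

(** * Spectral theory of traceless 2 x 2 matrices *)

Section Traceless.
Variable F : fieldType.
Implicit Types a b c lam : F.

(** The shape of [Mxi] over any field, with the same 1 x 1 blocks so that the two agree by
    conversion. *)
Definition traceless2 a b c : 'M[F]_2 :=
  @block_mx _ 1 1 1 1 a%:M b%:M c%:M (- a)%:M.

Lemma traceless2_sqr a b c : traceless2 a b c ^+ 2 = (a ^+ 2 + b * c)%:M.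
Proof.
rewrite expr2 [LHS](@mulmx_block _ 1 1 1 1 1 1) -!scalar_mxM -!raddfD.
rewrite (_ : a * b + b * - a = 0); last by ring.
rewrite (_ : c * a + - a * c = 0); last by ring.
rewrite (_ : c * b + - a * - a = a ^+ 2 + b * c); last by ring.
by rewrite raddf0 -expr2 [RHS](@scalar_mx_block _ 1 1).
Qed.

(** Indices use [lshift] and [rshift] so that the entries of a block matrix can be read off. *)
Lemma det_mx2 (S : comNzRingType) (A : 'M[S]_(1 + 1)) :
  \det A = A (lshift 1 0) (lshift 1 0) * A (rshift 1 0) (rshift 1 0)
         - A (lshift 1 0) (rshift 1 0) * A (rshift 1 0) (lshift 1 0).
Proof.
rewrite (expand_det_row _ 0) !big_ord_recl big_ord0 /cofactor !det_mx11 !mxE /=.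
rewrite addr0 !expr0 mul1r expr1 mulN1r mulrN.
by congr (A _ _ * A _ _ - A _ _ * A _ _); apply: val_inj.
Qed.

Lemma char_poly_traceless2 a b c :
  char_poly (traceless2 a b c) = 'X^2 - (a ^+ 2 + b * c)%:P.
Proof.
have splitl i : fintype.split (@lshift 1 1 i) = inl i := unsplitK (inl i).
have splitr i : fintype.split (@rshift 1 1 i) = inr i := unsplitK (inr i).
rewrite /char_poly [LHS]det_mx2 /traceless2 !(mxE, splitl, splitr) /=.
by rewrite !mulr1n !mulr0n !rmorphN rmorphD rmorphXn rmorphM; ring.
Qed.

Lemma eigenvalue_traceless2 a b c lam :
  eigenvalue (traceless2 a b c) lam = (lam ^+ 2 == a ^+ 2 + b * c).
Proof.
rewrite eigenvalue_root_char char_poly_traceless2 rootE.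
by rewrite hornerD hornerN hornerC hornerXn subr_eq0.
Qed.

Lemma mup_char_poly_traceless2 a b c :
  a ^+ 2 + b * c = 0 -> mup 0 (char_poly (traceless2 a b c)) = 2%N.
Proof.
(* Writing ['X] as X - 0 exhibits the polynomial as a power of a linear factor. *)
move=> abc; rewrite char_poly_traceless2 abc subr0 -['X]subr0 -polyC0.
by rewrite mup_XsubCX eqxx.
Qed.

Lemma traceless2_nilpotent a b c :
  a != 0 -> a ^+ 2 + b * c = 0 -> nilpotent_of_index (traceless2 a b c) 2.
Proof.
move=> a0 abc; split; first by rewrite traceless2_sqr abc raddf0.
case=> [_|[_|//]]; first by apply/eqP; rewrite expr0 oner_neq0.
move/(congr1 (@ulsubmx _ 1 1 1 1))/matrixP/(_ 0 0).
by rewrite expr1 block_mxKul !mxE mulr1n; apply/eqP.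
Qed.

End Traceless.

(** * Critical coupling, coercivity of [sigma] and the gap [rho] *)

Section MeanFieldGame.
Variables (R : realType) (d : nat) (nu : R) (K : 'rV[R]_d -> R).
Hypothesis nu_gt0 : 0 < nu.
Hypothesis K_continuous : continuous K.
Implicit Types (xi eta : 'rV[int]_d) (gamma : R).

Lemma critical_ratioE xi :
  critical_ratio nu K xi = nu ^+ 2 * kxi R xi / `|hat K xi|.
Proof. by []. Qed.

Lemma critical_ratio_gt0 xi :
  xi != 0 -> hat K xi < 0 -> 0 < critical_ratio nu K xi.
Proof.
move=> xi0 h0; rewrite critical_ratioE divr_gt0 ?normr_gt0 ?lt_eqF//.
by rewrite mulr_gt0 ?kxi_gt0 ?exprn_gt0.
Qed.

Lemma sigma_factor xi gamma : sigma nu K xi gamma =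
  kxi R xi * (nu ^+ 2 * kxi R xi + gamma * hat K xi).
Proof. by rewrite /sigma; ring. Qed.

(** Since hat K = - |hat K|, [sigma] is affine in [gamma] and vanishes exactly at the critical
    ratio; the factor k |hat K| is later the square of C_*. *)
Lemma sigma_critical_ratio xi gamma : xi != 0 -> hat K xi < 0 ->
  sigma nu K xi gamma =
  kxi R xi * `|hat K xi| * (critical_ratio nu K xi - gamma).
Proof.
move=> xi0 h0; rewrite sigma_factor critical_ratioE (ltr0_norm h0).
by field; rewrite lt_eqF.
Qed.

Lemma sigma_gt0_lt_critical_ratio xi gamma : xi != 0 -> hat K xi < 0 ->
  (0 < sigma nu K xi gamma) = (gamma < critical_ratio nu K xi).
Proof.
move=> xi0 h0; rewrite sigma_critical_ratio// pmulr_rgt0 ?subr_gt0//.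
by rewrite mulr_gt0 ?kxi_gt0 ?normr_gt0 ?lt_eqF.
Qed.

Lemma sigma_gt0 xi gamma : xi != 0 -> 0 <= gamma -> 0 <= hat K xi ->
  0 < sigma nu K xi gamma.
Proof.
move=> xi0 g0 h0; rewrite sigma_factor mulr_gt0 ?kxi_gt0// ltr_wpDr ?mulr_ge0//.
by rewrite mulr_gt0 ?kxi_gt0 ?exprn_gt0.
Qed.

(** The minimum is over the empty set, so [set_min] returns its default. *)
Lemma gamma_c_pinfty :
  ~ (exists xi, xi != 0 /\ hat K xi < 0) -> gamma_c nu K = +oo%E.
Proof.
move=> noxi; rewrite /gamma_c /set_min xgetPN// => y [[xi xiP _] _].
by apply: noxi; exists xi.
Qed.

Lemma gamma_c_attained : (exists xi, xi != 0 /\ hat K xi < 0) ->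
  exists xi, [/\ xi != 0, hat K xi < 0,
    gamma_c nu K = (critical_ratio nu K xi)%:E &
    forall eta, eta != 0 -> hat K eta < 0 ->
      critical_ratio nu K xi <= critical_ratio nu K eta].
Proof.
move=> ex; set C := torus_integral (fun x => `|K x|).
(* A nonzero coefficient forces a positive L^1 norm, so dividing by [C] gives a positive coercivity
   constant. *)
have C_gt0 : 0 < C.
  by have [xi [_ h0]] := ex; apply: lt_le_trans (norm_hat_le K_continuous xi);
    rewrite normr_gt0 lt_eqF.
have coercive xi : xi != 0 /\ hat K xi < 0 ->
    nu ^+ 2 * (2 * pi) ^+ 2 / C * enorm R xi ^+ 2 - 0 <= critical_ratio nu K xi.
  move=> [xi0 h0]; rewrite subr0 critical_ratioE kxiE mulrAC mulrA.
  apply: ler_wpM2l; first by rewrite -!exprMn sqr_ge0.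
  by rewrite lef_pV2 ?posrE ?normr_gt0 ?lt_eqF// norm_hat_le.
have a_gt0 : 0 < nu ^+ 2 * (2 * pi) ^+ 2 / C.
  by rewrite divr_gt0// mulr_gt0// exprn_gt0// mulr_gt0// pi_gt0.
have [xi [xi0 h0] xi_min] := coercive_minimum a_gt0 coercive ex.
exists xi; split=> // [|eta eta0 heta]; last exact: xi_min.
apply: set_min_eq; first by exists xi.
by move=> _ [eta etaP <-]; rewrite lee_fin; exact: xi_min.
Qed.

(** Modes with hat K >= 0 always have [sigma] positive; for the others positivity means that [gamma]
    lies below every critical ratio, that is below their minimum. *)
Lemma lt_gamma_cP gamma : 0 <= gamma ->
  (gamma%:E < gamma_c nu K)%E <->
  (forall xi, xi != 0 -> 0 < sigma nu K xi gamma).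
Proof.
move=> g0; have [ex|noxi] := pselect (exists xi, xi != 0 /\ hat K xi < 0).
- have [eta [eta0 heta -> eta_min]] := gamma_c_attained ex; rewrite lte_fin; split.
  + move=> g_lt xi xi0; have [|h0] := leP 0 (hat K xi); first exact: sigma_gt0.
    rewrite sigma_gt0_lt_critical_ratio//; exact: lt_le_trans g_lt (eta_min _ _ _).
  + by move=> /(_ _ eta0); rewrite sigma_gt0_lt_critical_ratio.
- rewrite gamma_c_pinfty// ltry; split=> // _ xi xi0.
  apply: sigma_gt0 => //; rewrite leNgt; apply/negP => h0.
  by apply: noxi; exists xi.
Qed.

(** A quadratic in k dominates k up to a constant, which depends on [gamma] only through the bound
    [M]. *)
Lemma sigma_coercive xi gamma M : 0 <= gamma -> gamma <= M ->
  (2 * pi) ^+ 2 * enorm R xi ^+ 2 -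
    (M * torus_integral (fun x => `|K x|) + 1) ^+ 2 / (4 * nu ^+ 2)
  <= sigma nu K xi gamma.
Proof.
move=> g0 gM; rewrite -kxiE; set C := torus_integral _; set k := kxi R xi.
have k0 : 0 <= k by exact: sqr_ge0.
have hC : `|gamma * hat K xi| <= M * C.
  by rewrite normrM (ger0_norm g0) ler_pM// norm_hat_le.
have [] := ler_normlP _ _ hC => hC' _.
(* Completing the square with M C + 1 instead of M C leaves a term k over. *)
have sq : k - (M * C + 1) ^+ 2 / (4 * nu ^+ 2) = nu ^+ 2 * k ^+ 2 - k * (M * C) -
    (nu * k - (M * C + 1) / (2 * nu)) ^+ 2.
  by field; rewrite gt_eqF.
rewrite sq sigma_factor -/k; apply: (@le_trans _ _ (nu ^+ 2 * k ^+ 2 - k * (M * C))).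
  by rewrite lerBlDr lerDl sqr_ge0.
have := ler_wpM2l k0 hC'; lra.
Qed.

(** One [delta] must serve every coupling in [0, gc], so a coercive lower bound independent of
    [gamma] is minimized. *)
Lemma sigma_gap gc xi0 : 0 <= gc ->
  (forall xi, xi != 0 -> xi != xi0 -> xi != - xi0 -> 0 < sigma nu K xi gc) ->
  exists2 delta, 0 < delta & forall xi gamma,
    xi != 0 -> xi != xi0 -> xi != - xi0 -> 0 <= gamma -> gamma <= gc ->
    delta <= sigma nu K xi gamma.
Proof.
move=> gc0 sigma_gc.
pose A := [set xi | [/\ xi != 0, xi != xi0 & xi != - xi0]].
(* sigma is affine in gamma, hence minimal at an endpoint of [0, gc]. *)
pose f xi := Num.min (sigma nu K xi 0) (sigma nu K xi gc).
have f_le xi gamma : xi != 0 -> 0 <= gamma -> gamma <= gc ->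
    f xi <= sigma nu K xi gamma.
  move=> xi_neq0 g0 ggc; rewrite ge_min !sigma_factor.
  rewrite !(ler_pM2l (kxi_gt0 R xi_neq0)) !lerD2l.
  have [h0|/ltW h0] := leP 0 (hat K xi); apply/orP; [left|right].
    by rewrite mul0r mulr_ge0.
  by rewrite ler_wnM2r.
have [A0|] := pselect (A !=set0); last first.
  move=> A0; exists 1 => // xi gamma xi1 xi2 xi3.
  by exfalso; apply: A0; exists xi.
have a_gt0 : 0 < (2 * pi : R) ^+ 2 by rewrite exprn_gt0// mulr_gt0// pi_gt0.
have coercive xi : A xi -> (2 * pi) ^+ 2 * enorm R xi ^+ 2 -
    (gc * torus_integral (fun x => `|K x|) + 1) ^+ 2 / (4 * nu ^+ 2) <= f xi.
  by move=> _; rewrite le_min !sigma_coercive.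
have [eta [eta1 eta2 eta3] eta_min] := coercive_minimum a_gt0 coercive A0.
exists (f eta).
  (* Positivity is automatic at coupling 0 and is the hypothesis at [gc]. *)
  rewrite lt_min sigma_gc// andbT sigma_factor mul0r addr0.
  by rewrite mulr_gt0 ?kxi_gt0// mulr_gt0 ?kxi_gt0 ?exprn_gt0.
move=> xi gamma xi1 xi2 xi3 g0 ggc.
by apply: le_trans (f_le _ _ _ g0 ggc) => //; exact: eta_min.
Qed.

(** Just below [gamma_c], [sigma] at [xi0] is under the gap of all modes other than [xi0] and
    [- xi0], so it realizes the minimum and the identity is exact. *)
Lemma rho_near_gamma_c xi0 : xi0 != 0 -> (gamma_c nu K < +oo)%E ->
  critical_set nu K = [set xi0; - xi0] ->
  \forall gamma \near (fine (gamma_c nu K))^'-,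
    rho nu K gamma = Num.sqrt (kxi R xi0 * `|hat K xi0|) *
                     Num.sqrt (fine (gamma_c nu K) - gamma).
Proof.
move=> xi0_neq0 gc_fin critE.
have [] : critical_set nu K xi0 by rewrite critE; left.
move=> _ h0 gcE.
have [eta [_ _ etaE eta_min]] := gamma_c_attained (ex_intro _ xi0 (conj xi0_neq0 h0)).
(* [xi0] inherits minimality from [eta], both ratios being equal to [gamma_c]. *)
have ratio_min xi : xi != 0 -> hat K xi < 0 ->
    critical_ratio nu K xi0 <= critical_ratio nu K xi.
  by move: etaE; rewrite -gcE => -[->]; exact: eta_min.
have gc_gt0 := critical_ratio_gt0 xi0_neq0 h0.
rewrite -gcE /=; set gc := critical_ratio nu K xi0.
have sigma0 gamma :
    sigma nu K xi0 gamma = kxi R xi0 * `|hat K xi0| * (gc - gamma).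
  exact: sigma_critical_ratio.
have sigmaN gamma : sigma nu K (- xi0) gamma = sigma nu K xi0 gamma.
  by rewrite /sigma /kxi enormN hatN.
have [|xi xi1 xi2 xi3|delta delta0 gap] := @sigma_gap gc xi0.
- exact: ltW.
- have [|h] := leP 0 (hat K xi); first exact/sigma_gt0/ltW.
  rewrite sigma_gt0_lt_critical_ratio// lt_neqAle ratio_min// andbT.
  (* Equal ratios would put [xi] in the critical set, which contains only [xi0] and [- xi0]. *)
  apply/eqP => gc_xi; have : critical_set nu K xi by split; rewrite -?gcE -?gc_xi.
  by rewrite critE => -[] /eqP; apply/negP.
have kh_gt0 : 0 < kxi R xi0 * `|hat K xi0|.
  by rewrite mulr_gt0 ?kxi_gt0 ?normr_gt0 ?lt_eqF.
near=> gamma.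
have g_gt0 : 0 < gamma by near: gamma; exact: nbhs_left_gt.
have g_lt : gamma < gc by near: gamma; exact: nbhs_left_lt.
(* Beyond this threshold k |hat K| (gc - gamma) is below [delta]. *)
have g_close : gc - delta / (kxi R xi0 * `|hat K xi0|) < gamma.
  by near: gamma; apply: nbhs_left_gt; rewrite ltrBlDr ltrDl divr_gt0.
rewrite -sqrtrM ?(ltW kh_gt0)// -sigma0.
apply: set_min_eq; first by exists xi0.
move=> _ [xi xi1 <-]; apply: ler_wsqrtr.
have [->//|xi2] := eqVneq xi xi0.
have [->|xi3] := eqVneq xi (- xi0); first by rewrite sigmaN.
apply: le_trans (gap _ _ xi1 xi2 xi3 (ltW g_gt0) (ltW g_lt)).
rewrite sigma0 mulrC -ler_pdivlMr//; lra.
Unshelve. all: by end_near. Qed.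

(** * Spectrum of [Mxi] and neutral modes *)

Hypothesis K_periodic : Zd_periodic K.
Hypothesis K_even : forall x, K (- x) = K x.

Lemma Mxi_traceless2 gamma xi : Mxi nu K gamma xi =
  traceless2 (nu * kxi R xi)%:C (- (gamma%:C * fourier_coef K xi))
    (- (kxi R xi)%:C).
Proof. by []. Qed.

Lemma sigmaE_complex gamma xi :
  ((nu * kxi R xi)%:C ^+ 2 +
    (- (gamma%:C * fourier_coef K xi)) * (- (kxi R xi)%:C) : R[i]) =
  (sigma nu K xi gamma)%:C.
Proof.
rewrite (fourier_coef_even K_continuous)// mulrNN -!rmorphM -rmorphXn -rmorphD.
by congr (_%:C); rewrite /sigma; ring.
Qed.

Lemma eigenvalue_Mxi gamma xi lam :
  eigenvalue (Mxi nu K gamma xi) lam = (lam ^+ 2 == (sigma nu K xi gamma)%:C).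
Proof. by rewrite Mxi_traceless2 eigenvalue_traceless2 sigmaE_complex. Qed.

Lemma eigenvalue_Mxi_pos gamma xi lam : 0 <= sigma nu K xi gamma ->
  eigenvalue (Mxi nu K gamma xi) lam <->
  lam = (Num.sqrt (sigma nu K xi gamma))%:C \/
  lam = - (Num.sqrt (sigma nu K xi gamma))%:C.
Proof.
move=> s0; rewrite eigenvalue_Mxi -{1}(sqr_sqrtr s0) rmorphXn eqf_sqr.
by split=> [/orP[]/eqP|[]->]; rewrite ?eqxx ?orbT; auto.
Qed.

Lemma eigenvalue_Mxi_neg gamma xi lam : sigma nu K xi gamma <= 0 ->
  eigenvalue (Mxi nu K gamma xi) lam <->
  lam = 0 +i* Num.sqrt `|sigma nu K xi gamma| \/
  lam = 0 -i* Num.sqrt `|sigma nu K xi gamma|.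
Proof.
move=> s0; set y := Num.sqrt _.
(* For [sigma] nonpositive, i y is a square root of it. *)
have sE : (sigma nu K xi gamma)%:C = (0 +i* y) ^+ 2.
  rewrite expr2; simpc; rewrite -expr2 sqr_sqrtr// ler0_norm// opprK.
  by apply/eqP; rewrite eq_complex /= !eqxx.
have -> : 0 -i* y = - (0 +i* y) by simpc.
rewrite eigenvalue_Mxi sE eqf_sqr.
by split=> [/orP[]/eqP|[]->]; rewrite ?eqxx ?orbT; auto.
Qed.

(** If [sigma] is nonpositive, i sqrt |sigma| is an eigenvalue, possibly 0; if it is positive, both
    eigenvalues are real and nonzero. *)
Lemma neutral_modeP gamma xi : xi != 0 ->
  neutral_mode nu K gamma xi <-> sigma nu K xi gamma <= 0.
Proof.
move=> xi0; split=> [[_ [lam [lamP Re0]]]|s0]; last first.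
  split=> //; exists (0 +i* Num.sqrt `|sigma nu K xi gamma|); split=> //.
  by apply/(eigenvalue_Mxi_neg _ s0); left.
rewrite leNgt; apply/negP => s0.
have sq0 : 0 < Num.sqrt (sigma nu K xi gamma) by rewrite sqrtr_gt0.
by move: Re0; have [->|->] := (eigenvalue_Mxi_pos _ (ltW s0)).1 lamP => /=; lra.
Qed.

End MeanFieldGame.

Theorem theorem1p5 (R : realType) (d : nat) (hd : (1 <= d)%N)
    (nu : R) (hnu : 0 < nu)
    (K : 'rV[R]_d -> R) (K_periodic : Zd_periodic K) (K_smooth : smooth K)
    (K_even : forall x : 'rV[R]_d, K (- x) = K x)
    (K_mean0 : torus_integral K = 0) :
  (forall gamma : R, 0 <= gamma ->
    (forall xi : 'rV[int]_d, xi != 0 ->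
      [/\ Mxi nu K gamma xi ^+ 2 = ((sigma nu K xi gamma)%:C)%:M,
          0 < sigma nu K xi gamma ->
            forall lam : R[i], eigenvalue (Mxi nu K gamma xi) lam <->
              lam = (Num.sqrt (sigma nu K xi gamma))%:C \/
              lam = - (Num.sqrt (sigma nu K xi gamma))%:C,
          sigma nu K xi gamma = 0 ->
            mup 0 (char_poly (Mxi nu K gamma xi)) = 2%N /\
            nilpotent_of_index (Mxi nu K gamma xi) 2
        & sigma nu K xi gamma < 0 ->
            forall lam : R[i], eigenvalue (Mxi nu K gamma xi) lam <->
              lam = 0 +i* Num.sqrt `|sigma nu K xi gamma| \/
              lam = 0 -i* Num.sqrt `|sigma nu K xi gamma|]) /\
    [<-> (forall xi : 'rV[int]_d, xi != 0 -> 0 < sigma nu K xi gamma);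
         (gamma%:E < gamma_c nu K)%E;
         ~ (exists xi : 'rV[int]_d, neutral_mode nu K gamma xi)]) /\
  (forall xi0 : 'rV[int]_d, xi0 != 0 ->
    (gamma_c nu K < +oo)%E ->
    critical_set nu K = [set xi0; - xi0] ->
    let gc := fine (gamma_c nu K) in
    let Cstar := Num.sqrt (kxi R xi0 * `|hat K xi0|) in
    rho nu K =
      (fun gamma : R => Cstar * Num.sqrt (gc - gamma))
      +o_ (gc^'-) (fun gamma : R => Num.sqrt (gc - gamma))).
Proof.
have K_continuous : continuous K by have [] := K_smooth [::].
split=> [gamma gamma0|xi0 xi0_neq0 gc_fin critE gc Cstar]; last first.
  (* The remainder vanishes near [gc] on the left, hence is bounded by any multiple [e] of the
     comparison function. *)
  apply/eqaddoP => _/posnumP[e]; near=> gamma.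
  rewrite /= !fctE (_ : rho nu K gamma = Cstar * Num.sqrt (gc - gamma)).
    by rewrite subrr normr0 mulr_ge0.
  by near: gamma; exact: rho_near_gamma_c.
split=> [xi xi0|].
  have Msigma := @sigmaE_complex _ _ nu _ K_continuous K_periodic K_even gamma xi.
  split.
  - by rewrite Mxi_traceless2 traceless2_sqr Msigma.
  - by move=> s0 lam; apply: eigenvalue_Mxi_pos => //; exact: ltW.
  - move=> s0; rewrite s0 in Msigma; split; first exact: mup_char_poly_traceless2.
    apply: traceless2_nilpotent => //.
    by rewrite eq_complex /= negb_and gt_eqF// mulr_gt0// kxi_gt0.
  - by move=> s0 lam; apply: eigenvalue_Mxi_neg => //; exact: ltW.
have gcP := lt_gamma_cP hnu K_continuous gamma0.
have neutralP := @neutral_modeP _ _ nu _ K_continuous K_periodic K_even gamma.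
tfae.
- by move/gcP.
- move/gcP => s_gt0 [xi neutral]; have [xi0 _] := neutral.
  by have /(neutralP _ xi0) := neutral; rewrite leNgt s_gt0.
- move=> no_neutral xi xi0; rewrite ltNge; apply/negP => s0; apply: no_neutral.
  by exists xi; apply/neutralP.
Unshelve. all: by end_near. Qed.
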